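(* Let $V$ be a finite-dimensional complex vector space and $\boldsymbol{B}=(B_0,\dots,B_N)$ a tuple of endomorphisms of $V$. Assume that $(V,\boldsymbol{B})$ satisfies $( * )$ and $( ** )$. (i) $\bigl(mc^q_{\lambda_2}(mc^q_{\lambda_1}(V)),\,mc^q_{\lambda_2}(mc^q_{\lambda_1}(\boldsymbol{B}))\bigr)$ is isomorphic to $\bigl(mc^q_{\lambda_1+\lambda_2}(V),\,mc^q_{\lambda_1+\lambda_2}(\boldsymbol{B})\bigr)$ for any $\lambda_1,\lambda_2\in\mathbb{C}$. (ii) $\bigl(mc^q_{-\lambda}(mc^q_{\lambda}(V)),\,mc^q_{-\lambda}(mc^q_{\lambda}(\boldsymbol{B}))\bigr)$ is isomorphic to $(V,\boldsymbol{B})$ for any $\lambda\in\mathbb{C}$.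
   Context: $q\in\mathbb{C}$ with $0<|q|<1$; a value of $\log q$ is fixed and $q^{a}=\exp(a\log q)$. $(V,\boldsymbol{B})$ satisfies $( * )$ if for all $i\in\{0,\dots,N\}$ and $\tau\in\mathbb{C}$: $\bigl(\bigcap_{i'\ne i}\operatorname{ker}B_{i'}\bigr)\cap\operatorname{ker}(B_i+\tau)=\{0\}$. It satisfies $( ** )$ if for all $i\in\{0,\dots,N\}$ and $\tau\in\mathbb{C}$: $\bigl(\sum_{i'\ne i}\operatorname{im}B_{i'}\bigr)+\operatorname{im}(B_i+\tau)=V$. $(V,\boldsymbol{B})$ is isomorphic to $(W,\boldsymbol{C})$ if there is a vector space isomorphism $\phi:V\to W$ with $\phi\circ B_j=C_j\circ\phi$ for $j=0,\dots,N$. $q$-middle convolution with parameter $\lambda\in\mathbb{C}$: for $j=0,\dots,N$ let $G_j^q(\lambda)$ be the endomorphism of $V^{\oplus N+1}$ sending $(u_0,\dots,u_N)$ to $(w_0,\dots,w_N)$ with $w_j=(1-q^{-\lambda})u_j+q^{-\lambda}\sum_{i=0}^{N}B_iu_i$ and $w_k=0$ for $k\ne j$. Let $\mathcal{K}^q=\operatorname{ker}B_0\oplus\cdots\oplus\operatorname{ker}B_N$ and $\mathcal{L}^q(\lambda)=\operatorname{ker}\bigl(G_0^q(\lambda)+\cdots+G_N^q(\lambda)\bigr)$; both are invariant under all $G_j^q(\lambda)$. Then $mc^q_\lambda(V)=V^{\oplus N+1}/(\mathcal{K}^q+\mathcal{L}^q(\lambda))$ and $mc^q_\lambda(\boldsymbol{B})$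 is the tuple of endomorphisms of this quotient induced by $(G_0^q(\lambda),\dots,G_N^q(\lambda))$. The composition $mc^q_{\lambda_2}\circ mc^q_{\lambda_1}$ means applying the construction with parameter $\lambda_2$ to the pair $(mc^q_{\lambda_1}(V),mc^q_{\lambda_1}(\boldsymbol{B}))$. *)

(* Defs.v *)
From HB Require Import structures.
From mathcomp Require Import all_boot all_order all_algebra complex.
From mathcomp Require Import reals sequences exp trigo.

Set Implicit Arguments.
Unset Strict Implicit.
Unset Printing Implicit Defensive.

Import GRing.Theory.
Local Open Scope ring_scope.
Local Open Scope quotient_scope.
Import VectorInternalTheory.

(* MathComp has no quotient of a vectType by a subspace: the Zmodule quotient
   of ring_quotient is equipped here with scaling and with a finite dimension. *)
Section QuotientSpace.
Variables (K : fieldType) (V : vectType K) (U : {vspace V}).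

Definition quotv : Type := Quotient.quot U.
HB.instance Definition _ := Choice.on quotv.
HB.instance Definition _ := GRing.Zmodule.on quotv.

Definition quotv_pi (v : V) : quotv := \pi_(Quotient.quot U) v.
Definition quotv_repr (x : quotv) : V := repr (x : Quotient.quot U).

Lemma quotv_reprK : cancel quotv_repr quotv_pi.
Proof. exact: reprK. Qed.

Lemma quotv_eqP v w : reflect (quotv_pi v = quotv_pi w) (v - w \in U).
Proof. by rewrite Quotient.idealrBE; apply: eqP. Qed.

Lemma quotv_piD : {morph quotv_pi : v w / v + w}.
Proof. by move=> v w; rewrite /quotv_pi (raddfD (\pi_(Quotient.quot U))). Qed.

Definition quotv_scale (a : K) (x : quotv) : quotv := quotv_pi (a *: quotv_repr x).

Lemma quotv_piZ a v : quotv_pi (a *: v) = quotv_scale a (quotv_pi v).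
Proof. by apply/quotv_eqP; rewrite -scalerBr rpredZ//; apply/quotv_eqP; rewrite quotv_reprK. Qed.

Lemma quotv_scaleA a b x :
  quotv_scale a (quotv_scale b x) = quotv_scale (a * b) x.
Proof. by rewrite -(quotv_reprK x) -!quotv_piZ scalerA. Qed.

Lemma quotv_scale1 : left_id 1 quotv_scale.
Proof. by move=> x; rewrite -(quotv_reprK x) -!quotv_piZ scale1r. Qed.

Lemma quotv_scaleDr : right_distributive quotv_scale +%R.
Proof.
move=> a x y; rewrite -(quotv_reprK x) -(quotv_reprK y).
by rewrite -quotv_piD -!quotv_piZ scalerDr quotv_piD.
Qed.

Lemma quotv_scaleDl x : {morph quotv_scale^~ x : a b / a + b}.
Proof.
by move=> a b; rewrite -(quotv_reprK x) -!quotv_piZ scalerDl quotv_piD.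
Qed.

HB.instance Definition _ := GRing.Zmodule_isLmodule.Build K quotv
  quotv_scaleA quotv_scale1 quotv_scaleDr quotv_scaleDl.

Lemma quotv_pi_is_linear : linear quotv_pi.
Proof. by move=> a v w; rewrite quotv_piD quotv_piZ. Qed.
HB.instance Definition _ := GRing.isLinear.Build K V quotv _ quotv_pi
  quotv_pi_is_linear.

Lemma quotv_vect_iso : Vector.axiom (dim (subvs_of (U^C)%VS)) quotv.
Proof.
have capUC : (U^C :&: U)%VS = 0%VS by rewrite capvC capv_compl.
have piD v : daddv_pi U U^C v + daddv_pi U^C U v = v.
  by rewrite daddv_pi_add ?capv_compl// addv_complf memvf.
have piU v : daddv_pi U^C U v - v \in U.
  by rewrite -[X in _ - X]piD opprD addrCA subrr addr0 rpredN memv_pi.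
have pi0 v : v \in U -> daddv_pi U^C U v = 0.
  move=> vU; apply: (addrI (daddv_pi U U^C v)).
  by rewrite piD addr0 daddv_pi_id// capv_compl.
have piE v w : quotv_pi v = quotv_pi w -> daddv_pi U^C U v = daddv_pi U^C U w.
  move/quotv_eqP => /pi0; rewrite raddfB /= => /eqP.
  by rewrite subr_eq0 => /eqP.
pose g x := v2r (vsproj U^C (daddv_pi U^C U (quotv_repr x))).
exists g.
  move=> a x y; rewrite /g -linearP -linearP; congr (v2r (vsproj _ _)).
  rewrite -linearP; apply: piE.
  by rewrite quotv_reprK quotv_piD quotv_piZ !quotv_reprK.
exists (fun r => quotv_pi (vsval (r2v r : subvs_of U^C%VS))) => [x|r].
  rewrite /g v2rK vsprojK ?memv_pi// -[RHS]quotv_reprK.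
  by apply/quotv_eqP.
rewrite /g (piE _ (vsval (r2v r : subvs_of U^C%VS))) ?quotv_reprK//.
by rewrite daddv_pi_id ?subvsP// vsvalK r2vK.
Qed.

HB.instance Definition _ := Lmodule_hasFinDim.Build K quotv quotv_vect_iso.

(* Meaningful only when f maps U into U; see quotv_endE. *)
Definition quotv_end (f : 'End(V)) : 'End(quotv) :=
  linfun (fun x : quotv => quotv_pi (f (quotv_repr x))).

Lemma quotv_endE (f : 'End(V)) (v : V) :
  (f @: U <= U)%VS -> quotv_end f (quotv_pi v) = quotv_pi (f v).
Proof.
move=> fU; pose h x := quotv_pi (f (quotv_repr x)).
have hE w : h (quotv_pi w) = quotv_pi (f w).
  apply/quotv_eqP; rewrite -linearB; apply: (subvP fU); apply: memv_img.
  by apply/quotv_eqP; rewrite quotv_reprK.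
have hL : linear h.
  move=> a x y; rewrite -(quotv_reprK x) -(quotv_reprK y) -linearP !hE.
  by rewrite !linearP.
pose hM := GRing.isLinear.Build K quotv quotv _ h hL.
pose hl : {linear quotv -> quotv} := HB.pack h hM.
by rewrite -hE /quotv_end (lfunE hl).
Qed.

End QuotientSpace.

Section Tuples.
Variables (K : fieldType) (N : nat).

Definition star (V : vectType K) (B : 'I_N.+1 -> 'End(V)) : Prop :=
  forall (i : 'I_N.+1) (tau : K),
    ((\bigcap_(i' | i' != i) lker (B i')) :&: lker (B i + tau *: \1%VF)%R)%VS = 0%VS.

Definition dblstar (V : vectType K) (B : 'I_N.+1 -> 'End(V)) : Prop :=
  forall (i : 'I_N.+1) (tau : K),
    ((\sum_(i' | i' != i) limg (B i')) + limg (B i + tau *: \1%VF)%R)%VS = fullv.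

Definition tuple_iso (V W : vectType K)
    (B : 'I_N.+1 -> 'End(V)) (C : 'I_N.+1 -> 'End(W)) : Prop :=
  exists phi : 'Hom(V, W),
    bijective phi /\ forall j, (phi \o B j)%VF = (C j \o phi)%VF.

End Tuples.

(* The construction depends on q and lambda only through c = q^(- lambda). *)
Section Convolution.
Variables (K : fieldType) (N : nat) (V : vectType K).
Variables (B : 'I_N.+1 -> 'End(V)) (c : K).

Definition conv_fun (j : 'I_N.+1) (u : {ffun 'I_N.+1 -> V}) :
    {ffun 'I_N.+1 -> V} :=
  [ffun k => if k == j then (1 - c) *: u j + c *: \sum_i B i (u i) else 0].

Lemma conv_fun_is_linear j : linear (conv_fun j).
Proof.
move=> a u v; apply/ffunP=> k; rewrite !ffunE; case: eqP => _; last first.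
  by rewrite scaler0 addr0.
under eq_bigr do rewrite !ffunE linearP.
rewrite big_split /= -scaler_sumr !scalerDr !scalerA.
by rewrite (mulrC (1 - c)) (mulrC c a) addrACA.
Qed.
HB.instance Definition _ j := GRing.isLinear.Build K _ _ _ (conv_fun j)
  (conv_fun_is_linear j).

Definition conv (j : 'I_N.+1) : 'End({ffun 'I_N.+1 -> V}) :=
  linfun (conv_fun j).

Definition ffun_proj (i : 'I_N.+1) (u : {ffun 'I_N.+1 -> V}) : V := u i.
Lemma ffun_proj_is_linear i : linear (ffun_proj i).
Proof. by move=> a u v; rewrite /ffun_proj !ffunE. Qed.
HB.instance Definition _ i := GRing.isLinear.Build K _ _ _ (ffun_proj i)
  (ffun_proj_is_linear i).

Definition conv_K : {vspace {ffun 'I_N.+1 -> V}} :=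
  (\bigcap_i (linfun (ffun_proj i) @^-1: lker (B i)))%VS.

Lemma mem_conv_K (u : {ffun 'I_N.+1 -> V}) : reflect (forall i, B i (u i) = 0) (u \in conv_K).
Proof.
apply: (iffP idP) => [/subv_bigcapP h i|h].
  by have := h i isT; rewrite -memvE -memv_preim memv_ker lfunE => /eqP.
apply/subv_bigcapP => i _.
by rewrite -memvE -memv_preim memv_ker lfunE /= /ffun_proj h.
Qed.

Definition conv_L : {vspace {ffun 'I_N.+1 -> V}} := lker (\sum_j conv j).

Lemma convE j (u : {ffun 'I_N.+1 -> V}) k :
  conv j u k = if k == j then (1 - c) *: u j + c *: \sum_i B i (u i) else 0.
Proof. by rewrite lfunE ffunE. Qed.

Lemma conv_L_eq0 (u : {ffun 'I_N.+1 -> V}) j : u \in conv_L -> conv j u = 0.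
Proof.
rewrite memv_ker sum_lfunE => /eqP/ffunP/(_ j); rewrite sum_ffunE (bigD1 j)//=.
rewrite big1 ?addr0 => [uj|i ij]; last by rewrite convE eq_sym (negPf ij).
apply/ffunP => k; rewrite [RHS]ffunE.
by have [->|kj] := eqVneq k j; [rewrite uj ffunE | rewrite convE (negPf kj)].
Qed.

Lemma conv_stable j : (conv j @: (conv_K + conv_L) <= conv_K + conv_L)%VS.
Proof.
apply/subvP => _ /memv_imgP[_ /memv_addP[u uK [v vL ->]] ->].
rewrite linearD /= (conv_L_eq0 _ vL) addr0 -[conv j u]addr0 memv_add ?mem0v//.
move/mem_conv_K: uK => uK; apply/mem_conv_K => k; rewrite convE.
rewrite big1 ?scaler0 ?addr0//.
by case: eqP => [->|_]; rewrite ?linearZ/= ?uK ?scaler0 ?linear0.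
Qed.

Definition mc_space : vectType K := quotv (conv_K + conv_L)%VS.
Definition mc_tuple (j : 'I_N.+1) : 'End(mc_space) :=
  quotv_end (conv_K + conv_L)%VS (conv j).


Lemma mc_tupleE j (u : {ffun 'I_N.+1 -> V}) :
  mc_tuple j (quotv_pi (conv_K + conv_L) u) = quotv_pi (conv_K + conv_L) (conv j u).
Proof. exact/quotv_endE/conv_stable. Qed.

End Convolution.

Section QConvolution.
Variable R : realType.

(* The complex exponential, by Euler's formula. *)
Definition cexp (z : R[i]) : R[i] :=
  ((expR (Re z) * cos (Im z)) +i* (expR (Re z) * sin (Im z)))%C.

(* q ^ a for the branch logq of log q. *)
Definition qpow (logq a : R[i]) : R[i] := cexp (a * logq).

Variables (logq lambda : R[i]) (N : nat) (V : vectType R[i]).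
Variable B : 'I_N.+1 -> 'End(V).

Definition mcq_space : vectType R[i] := mc_space B (qpow logq (- lambda)).
Definition mcq (j : 'I_N.+1) : 'End(mcq_space) :=
  mc_tuple B (qpow logq (- lambda)) j.

End QConvolution.

(* Main.v *)
From HB Require Import structures.
Require Import Defs.
From mathcomp Require Import all_boot all_order all_algebra complex.
From mathcomp Require Import reals sequences exp trigo ring.

Set Implicit Arguments.
Unset Strict Implicit.
Unset Printing Implicit Defensive.

Import GRing.Theory.
Local Open Scope ring_scope.

(** Write S u = sum_i B_i u_i and c = q^(-lambda), so that the j-th convolution
    operator sends u to the family concentrated at j with value
    (1 - c) u_j + c S u.  Let I be the index set.  The twofold convolution with
    parameters c and then d is a quotient of V^(I x I): an element is
    represented by a family x of vectors x_j in V^I.  Consider the map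

      phi : V^(I x I) -> V^I,    phi(x)_j = (1 - c) x_jj + c S x_j,

    which is the sum of the images of the x_j under the first-step operators.
    The operator of the twofold convolution sends x to the family concentrated
    at k with value (1 - d) x_k + d phi(x), and phi turns it into
    (1 - d) phi(x)_k + d ((1 - c) phi(x)_k + c S phi(x)), that is, into the
    k-th convolution operator of parameter c d applied to phi(x).  Hence phi
    descends to the required isomorphism as soon as it is onto and the
    preimage of K + L_(cd) is the subspace divided out in the twofold
    convolution.

    Surjectivity ([conv_diag_surj]) is condition ( ** ).  For the kernels, the
    condition ( * ) shows that a vector concentrated at j lies in K + L_c only
    if its value is in ker B_j ([conv_KL_single]); so the K-part of the second
    step is the preimage of K under phi.  An x in the L-part satisfies
    (1 - d) x_j + d phi(x) in K + L_c for all j, and applying the first-step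
    operators shows that all operators of parameter c d send phi(x) into K;
    by ( * ) again this forces phi(x) into K + L_(cd) ([conv_ker_KL],
    [mc_mc_rel_diag]).  Conversely, for d <> 1 an element l of L_(cd) is the
    image under phi of a multiple of the constant family (l, ..., l), which
    lies in the L-part ([diag_mc_mc_rel]).

    For c = 1 the map S itself identifies the convolution with (V, B)
    ([mc1_iso]).  Both statements then follow from
    q^(-l1) q^(-l2) = q^(-(l1+l2)) and q^0 = 1. *)

(** * Isomorphisms of tuples *)

Section TupleIso.
Variables (K : fieldType) (N : nat).

(** Y and Z are both X divided by the common kernel, and the operators on both
    sides are induced by the same maps T j.  This avoids descending a map
    through quotients by hand, which matters for a quotient of a space of
    families in a quotient. *)
Lemma tuple_iso_of_presentations (X Y Z : vectType K)
    (f : {linear X -> Y}) (g : {linear X -> Z}) (T : 'I_N.+1 -> X -> X)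
    (C : 'I_N.+1 -> 'End(Y)) (D : 'I_N.+1 -> 'End(Z)) :
    (forall y, exists x, f x = y) -> (forall z, exists x, g x = z) ->
    (forall x, f x = 0 <-> g x = 0) ->
    (forall j x, f (T j x) = C j (f x)) -> (forall j x, g (T j x) = D j (g x)) ->
  tuple_iso C D.
Proof.
move=> fS gS fg fT gT.
have eqfg x x' : f x = f x' <-> g x = g x'.
  split=> [h|h]; apply/eqP; rewrite -subr_eq0 -linearB; apply/eqP/fg.
    by rewrite linearB h subrr.
  by rewrite linearB h subrr.
have limg_full (W : vectType K) (h : {linear X -> W}) :
    (forall y, exists x, h x = y) -> forall y, linfun h ((linfun h)^-1%VF y) = y.
  move=> hS y; apply: limg_lfunVK; have [x <-] := hS y.
  by rewrite -[h x]lfunE memv_img ?memvf.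
have fK y : f ((linfun f)^-1%VF y) = y.
  by have := limg_full _ f fS y; rewrite lfunE.
have gK z : g ((linfun g)^-1%VF z) = z.
  by have := limg_full _ g gS z; rewrite lfunE.
exists (linfun g \o (linfun f)^-1)%VF; split.
  exists (linfun f \o (linfun g)^-1)%VF => y; rewrite !comp_lfunE !lfunE.
    by rewrite -[RHS]fK; apply/eqfg; rewrite gK.
  by rewrite -[RHS]gK; apply/eqfg; rewrite fK.
move=> j; apply/lfunP => y; rewrite !comp_lfunE !lfunE.
by rewrite -gT; apply/eqfg; rewrite fK fT fK.
Qed.

Lemma tuple_iso_trans (U V W : vectType K) (A : 'I_N.+1 -> 'End(U))
    (B : 'I_N.+1 -> 'End(V)) (C : 'I_N.+1 -> 'End(W)) :
  tuple_iso A B -> tuple_iso B C -> tuple_iso A C.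
Proof.
move=> [f [fB fAB]] [g [gB gBC]]; exists (g \o f)%VF; split.
  apply: (eq_bij (bij_comp gB fB)) => u; by rewrite comp_lfunE.
by move=> j; rewrite -comp_lfunA fAB !comp_lfunA gBC.
Qed.

End TupleIso.

(** * The convolution operators and the subspaces K and L *)

Section Convolution.
Variables (K : fieldType) (N : nat).

Lemma quotv_pi_eq0 (V : vectType K) (U : {vspace V}) v :
  quotv_pi U v = 0 <-> v \in U.
Proof.
rewrite -[0](linear0 (quotv_pi U)) -[v in v \in U]subr0.
by split=> /quotv_eqP.
Qed.

Definition single (V : zmodType) (j : 'I_N.+1) (v : V) : {ffun 'I_N.+1 -> V} :=
  [ffun k => if k == j then v else 0].

Variables (V : vectType K) (B : 'I_N.+1 -> 'End(V)).

Definition wsum (u : {ffun 'I_N.+1 -> V}) : V := \sum_i B i (u i).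
Lemma wsum_is_linear : linear wsum.
Proof.
move=> a u v; rewrite /wsum scaler_sumr -big_split /=.
by apply: eq_bigr => i _; rewrite !ffunE linearP.
Qed.
HB.instance Definition _ := GRing.isLinear.Build K _ _ _ wsum wsum_is_linear.

Lemma wsum_single j v : wsum (single j v) = B j v.
Proof.
rewrite /wsum (bigD1 j)//= ffunE eqxx big1 ?addr0// => i ij.
by rewrite ffunE (negPf ij) linear0.
Qed.

Lemma wsum_K u : u \in conv_K B -> wsum u = 0.
Proof. by move=> /mem_conv_K uK; rewrite /wsum big1. Qed.

Lemma conv_single c j u :
  conv B c j u = single j ((1 - c) *: u j + c *: wsum u).
Proof. by apply/ffunP => k; rewrite convE ffunE. Qed.

Lemma mem_conv_L c (u : {ffun 'I_N.+1 -> V}) :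
  reflect (forall j, (1 - c) *: u j + c *: wsum u = 0) (u \in conv_L B c).
Proof.
apply: (iffP idP) => [uL j|h].
  by have /ffunP/(_ j) := conv_L_eq0 j uL; rewrite convE eqxx ffunE.
rewrite memv_ker sum_lfunE big1// => j _.
by rewrite conv_single h; apply/ffunP => k; rewrite !ffunE if_same.
Qed.

Lemma single_K j v : (single j v \in conv_K B) = (B j v == 0).
Proof.
apply/mem_conv_K/eqP => [/(_ j)|h i]; rewrite ffunE ?eqxx//.
by case: eqP => [->|_]; rewrite ?linear0.
Qed.

(** Modulo L the j-th operator only sees the K-part, on which S vanishes. *)
Lemma conv_KL_ker c (u : {ffun 'I_N.+1 -> V}) j :
  u \in (conv_K B + conv_L B c)%VS -> B j ((1 - c) *: u j + c *: wsum u) = 0.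
Proof.
move=> /memv_addP[k kK [l /mem_conv_L lL ->]].
rewrite [wsum _]linearD /= wsum_K// add0r ffunE scalerDr -addrA lL addr0.
by rewrite linearZ /= (mem_conv_K _ _ kK) scaler0.
Qed.

Section Star.
Hypothesis hstar : star B.

Lemma star_ker j (tau : K) v :
  (forall i, i != j -> B i v = 0) -> B j v + tau *: v = 0 -> v = 0.
Proof.
move=> h1 h2; apply/eqP; rewrite -memv0 -(hstar j tau) memv_cap; apply/andP; split.
  by rewrite memvE; apply/subv_bigcapP => i ij; rewrite -memvE memv_ker h1.
by rewrite memv_ker add_lfunE scale_lfunE id_lfunE h2.
Qed.

(** If c <> 1, the L-part of the family is constant, say with value w.  At an
    index i <> j the family vanishes, so that B_i w = 0, and membership in L
    becomes (1 - c) w + c B_j w = 0; then ( * ) with tau = (1 - c) / c gives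
    w = 0.  If c = 1, both K and L lie in ker S, and S maps the family to
    B_j v. *)
Lemma conv_KL_single c j v : c != 0 ->
  (single j v \in (conv_K B + conv_L B c)%VS) = (B j v == 0).
Proof.
move=> c0; apply/idP/eqP => [|Bv]; last first.
  by apply: (subvP (addvSl _ _)); rewrite single_K Bv.
move=> /memv_addP[k kK [l /mem_conv_L lL kl]].
have [c1|c1] := eqVneq c 1.
  rewrite -wsum_single kl linearD /= wsum_K// add0r.
  by have := lL j; rewrite c1 subrr scale0r add0r scale1r.
have c1' : 1 - c != 0 by rewrite subr_eq0 eq_sym.
have lj i : l i = l j.
  apply: (scalerI c1'); apply: (addIr (c *: wsum l)); by rewrite !lL.
have /mem_conv_K kK' := kK.
have Bl i : i != j -> B i (l j) = 0.
  move=> ij; have /ffunP/(_ i) := kl; rewrite !ffunE (negPf ij) lj => /esym.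
  by move=> /(congr1 (B i)); rewrite linearD /= kK' add0r linear0.
have l0 : l j = 0.
  apply: (@star_ker j ((1 - c) / c)) => //; apply: (scalerI c0).
  rewrite scaler0 scalerDr scalerA mulrCA divff// mulr1 addrC -[RHS](lL j).
  congr (_ + _ *: _); rewrite /wsum (bigD1 j)//= big1 ?addr0// => i ij.
  by rewrite lj Bl.
by have /ffunP/(_ j) := kl; rewrite !ffunE eqxx l0 addr0 => ->.
Qed.

(** When c = 1 the hypothesis says that the single vector S u is killed by
    every B_j, hence is 0 by ( * ); otherwise the K-part of u is read off from
    the values of the operators divided by 1 - c. *)
Lemma conv_ker_KL c (u : {ffun 'I_N.+1 -> V}) :
  (forall j, B j ((1 - c) *: u j + c *: wsum u) = 0) ->
  u \in (conv_K B + conv_L B c)%VS.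
Proof.
move=> h; have [c1|c1] := eqVneq c 1.
  have Su0 : wsum u = 0.
    have Bu i : B i (wsum u) = 0.
      by have := h i; rewrite c1 subrr scale0r add0r scale1r.
    by apply: (@star_ker ord0 0) => //; rewrite Bu scale0r addr0.
  apply: (subvP (addvSr _ _)); apply/mem_conv_L => j.
  by rewrite c1 subrr scale0r add0r scale1r Su0.
have c1' : 1 - c != 0 by rewrite subr_eq0 eq_sym.
pose k := [ffun j => (1 - c)^-1 *: ((1 - c) *: u j + c *: wsum u)].
have kK : k \in conv_K B.
  by apply/mem_conv_K => j; rewrite ffunE linearZ /= h scaler0.
rewrite -[u](addrNK k) addrC memv_add//; apply/mem_conv_L => j.
rewrite [wsum _]linearB /= (wsum_K kK) subr0 !ffunE scalerBr scalerA divff// scale1r.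
by rewrite opprD addrA subrr sub0r addNr.
Qed.

End Star.

End Convolution.

(** * The diagonal map and the kernel of the twofold convolution *)

Section Composition.
Variables (K : fieldType) (N : nat) (V : vectType K) (B : 'I_N.+1 -> 'End(V)).
Variables (c d : K).
Hypotheses (hstar : star B) (hdbl : dblstar B) (c0 : c != 0).

Local Notation I := 'I_N.+1.
Local Notation X := {ffun I -> {ffun I -> V}}.
Local Notation KL e := (conv_K B + conv_L B e)%VS.
Local Notation M := (mc_space B c).
Local Notation C := (mc_tuple B c).

(** The map phi of the introduction. *)
Definition conv_diag (x : X) : {ffun I -> V} :=
  [ffun j => (1 - c) *: x j j + c *: wsum B (x j)].
Lemma conv_diag_is_linear : linear conv_diag.
Proof.
move=> a x y; apply/ffunP => j; rewrite !ffunE (linearP (wsum B)) /=.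
by rewrite !scalerDr !scalerA (mulrC a (1 - c)) (mulrC a c) addrACA.
Qed.
HB.instance Definition _ :=
  GRing.isLinear.Build K _ _ _ conv_diag conv_diag_is_linear.

Lemma conv_diag_surj u : exists x, conv_diag x = u.
Proof.
suff h j : exists y : {ffun I -> V}, (1 - c) *: y j + c *: wsum B y = u j.
  have [x hx] := fin_all_exists h.
  by exists [ffun j => x j]; apply/ffunP => j; rewrite !ffunE hx.
have: u j \in fullv by rewrite memvf.
(* With tau = (1 - c) / c one has c (B_j + tau) = (1 - c) + c B_j. *)
rewrite -(hdbl j ((1 - c) / c)) => /memv_addP[s /memv_sumP[b hb ->]].
move=> [_ /memv_imgP[v _ ->] ->].
have hb' i : exists y, i != j -> B i y = b i.
  have [->|ij] := eqVneq i j; first by exists 0.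
  by have /memv_imgP[y _ ->] := hb i ij; exists y.
have [y hy] := fin_all_exists hb'.
exists [ffun i => c^-1 *: (if i == j then v else y i)].
have -> : wsum B [ffun i => c^-1 *: (if i == j then v else y i)] =
          c^-1 *: (B j v + \sum_(i | i != j) b i).
  rewrite /wsum (bigD1 j)//= ffunE eqxx linearZ scalerDr scaler_sumr.
  by congr (_ + _); apply: eq_bigr => i ij; rewrite ffunE (negPf ij) linearZ /= hy.
rewrite ffunE eqxx scalerA scalerKV// add_lfunE scale_lfunE id_lfunE.
by rewrite [LHS]addrC [LHS]addrAC [LHS]addrC.
Qed.

Definition fam_pi (x : X) : {ffun I -> M} := [ffun j => quotv_pi (KL c) (x j)].
Lemma fam_pi_is_linear : linear fam_pi.
Proof. by move=> a x y; apply/ffunP => j; rewrite !ffunE linearP. Qed.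
HB.instance Definition _ :=
  GRing.isLinear.Build K _ _ _ fam_pi fam_pi_is_linear.

Definition mc_mc_pi : {linear X -> mc_space C d} :=
  quotv_pi (conv_K C + conv_L C d)%VS \o fam_pi.

Definition diag_pi : {linear X -> mc_space B (d * c)} :=
  quotv_pi (KL (d * c)) \o conv_diag.

Lemma fam_pi_surj y : exists x, fam_pi x = y.
Proof.
exists [ffun j => quotv_repr (y j)]; apply/ffunP => j.
by rewrite !ffunE quotv_reprK.
Qed.

Lemma wsum_fam_pi x : wsum C (fam_pi x) = quotv_pi (KL c) (conv_diag x).
Proof.
rewrite /wsum; under eq_bigr do rewrite ffunE mc_tupleE.
rewrite -linear_sum; congr (quotv_pi _ _); apply/ffunP => k.
rewrite sum_ffunE (bigD1 k)//= big1 ?addr0 => [|i ik].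
  by rewrite conv_single !ffunE eqxx.
by rewrite convE eq_sym (negPf ik).
Qed.

Lemma fam_pi_K x : (fam_pi x \in conv_K C) = (conv_diag x \in conv_K B).
Proof.
suff h j : C j (fam_pi x j) = 0 <-> B j (conv_diag x j) = 0.
  by apply/mem_conv_K/mem_conv_K => hx j; apply/h.
rewrite ffunE mc_tupleE quotv_pi_eq0 conv_single conv_KL_single// ffunE.
by split=> /eqP.
Qed.

Lemma fam_pi_L (x : X) :
  reflect (forall j, (1 - d) *: x j + d *: conv_diag x \in KL c)
          (fam_pi x \in conv_L C d).
Proof.
have hE j : (1 - d) *: fam_pi x j + d *: wsum C (fam_pi x) =
            quotv_pi (KL c) ((1 - d) *: x j + d *: conv_diag x).
  by rewrite wsum_fam_pi ffunE linearD !linearZ.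
apply: (iffP (mem_conv_L _ _ _)) => h j.
  by apply/quotv_pi_eq0; rewrite -hE.
by rewrite hE; apply/quotv_pi_eq0.
Qed.

Lemma conv_param_comp (p t : V) :
  (1 - d) *: p + d *: ((1 - c) *: p + c *: t) =
  (1 - d * c) *: p + (d * c) *: t.
Proof.
rewrite scalerDr !scalerA addrA -scalerDl; congr (_ *: _ + _).
by rewrite mulrBr mulr1 addrA addrNK.
Qed.

(** The reason why phi intertwines the two kinds of operators.  By linearity the
    left-hand side is 1 - d times the first-step value at x_j, which is
    phi(x)_j, plus d times the first-step value at phi(x); the coefficients
    then combine by (1 - d) + d (1 - c) = 1 - d c. *)
Lemma conv_diag_step (x : X) j (w := (1 - d) *: x j + d *: conv_diag x) :
  (1 - c) *: w j + c *: wsum B w =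
  (1 - d * c) *: conv_diag x j + (d * c) *: wsum B (conv_diag x).
Proof.
rewrite -conv_param_comp [X in _ = (1 - d) *: X + _]ffunE /w.
move: (conv_diag x) => p.
rewrite (linearD (wsum B)) !(linearZ_LR (wsum B)) !ffunE.
by rewrite !scalerDr !scalerA addrACA !(mulrC (1 - d)) !(mulrC d).
Qed.

(** For each j, the j-th first-step operator maps the relation
    (1 - d) x_j + d phi(x) in K + L_c to
    (1 - cd) phi(x)_j + cd S phi(x) in ker B_j. *)
Lemma mc_mc_rel_diag x :
  fam_pi x \in (conv_K C + conv_L C d)%VS -> conv_diag x \in KL (d * c).
Proof.
move=> /memv_addP[y1 + [y2 + e]].
have [x1 x1E] := fam_pi_surj y1; rewrite -x1E fam_pi_K => x1K.
have -> : y2 = fam_pi (x - x1) by rewrite linearB /= e x1E [RHS]addrC addKr.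
move=> /fam_pi_L h; rewrite -[x](addrNK x1) addrC linearD /= rpredD//.
  by apply: (subvP (addvSl _ _)).
move: (x - x1) h => z h; apply: conv_ker_KL => // j.
by rewrite -conv_diag_step conv_KL_ker.
Qed.

(** If phi(x) = k + l, lift k through phi to y; then y lies in the K-part and
    x - y maps to l.  For d = 1 the L-part is the preimage of K + L_c under
    phi, and it contains x - y because l lies in L_c.  For d <> 1 the constant
    family with value -d/(1-d) l lies in the L-part and phi maps it to l as
    well, so that it differs from x - y by an element of ker phi. *)
Lemma diag_mc_mc_rel x :
  conv_diag x \in KL (d * c) -> fam_pi x \in (conv_K C + conv_L C d)%VS.
Proof.
move=> /memv_addP[k kK [l lL xkl]].
have [y yk] := conv_diag_surj k.
have yK : fam_pi y \in conv_K C by rewrite fam_pi_K yk.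
have xyl : conv_diag (x - y) = l by rewrite linearB /= xkl yk [LHS]addrC addKr.
rewrite -[x](addrNK y) addrC linearD /= rpredD//.
  by apply: (subvP (addvSl _ _)).
have [d1|d1] := eqVneq d 1.
  apply: (subvP (addvSr _ _)); apply/fam_pi_L => j.
  rewrite xyl d1 subrr scale0r add0r scale1r.
  by apply: (subvP (addvSr _ _)); rewrite -[c]mul1r -d1.
have d1' : 1 - d != 0 by rewrite subr_eq0 eq_sym.
pose z : X := [ffun=> (- (d / (1 - d))) *: l].
have zl : conv_diag z = l.
  apply/ffunP => j; rewrite !ffunE (linearZ_LR (wsum B)).
  rewrite [c *: _]scalerA (mulrC c) -scalerA [(1 - c) *: _]scalerA.
  rewrite (mulrC (1 - c)) -scalerA -scalerDr; apply: (scalerI d1').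
  rewrite scalerA mulrN mulrCA divff// mulr1 scaleNr.
  move/mem_conv_L: lL => /(_ j); rewrite -conv_param_comp => /eqP.
  by rewrite addr_eq0 => /eqP.
rewrite -[x - y](addrNK z) linearD /= memv_add//.
  by rewrite fam_pi_K linearB /= xyl zl subrr mem0v.
apply/fam_pi_L => j; rewrite zl ffunE scaleNr scalerN scalerA.
by rewrite mulrCA divff// mulr1 addNr mem0v.
Qed.

Theorem mc_mc_iso : tuple_iso (mc_tuple C d) (mc_tuple B (d * c)).
Proof.
(* The k-th operator of the second step, written on representatives. *)
pose T (k : I) (x : X) : X := single k ((1 - d) *: x k + d *: conv_diag x).
apply: (@tuple_iso_of_presentations _ _ _ _ _ mc_mc_pi diag_pi T).
- move=> y; have [x xy] := fam_pi_surj (quotv_repr y).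
  by exists x; rewrite /= xy quotv_reprK.
- move=> y; have [x xy] := conv_diag_surj (quotv_repr y).
  by exists x; rewrite /= xy quotv_reprK.
- move=> x; split=> /= /quotv_pi_eq0 h; apply/quotv_pi_eq0.
    exact: mc_mc_rel_diag.
  exact: diag_mc_mc_rel.
- move=> k x /=; rewrite mc_tupleE conv_single wsum_fam_pi; congr (quotv_pi _ _).
  apply/ffunP => j; rewrite !ffunE.
  by case: eqP => _; rewrite ?linear0// linearD !linearZ.
- move=> k x /=; rewrite mc_tupleE conv_single; congr (quotv_pi _ _).
  apply/ffunP => j; rewrite -conv_diag_step [LHS]ffunE /T.
  rewrite ![single _ _ _]ffunE; case: eqP => [->//|_].
  by rewrite linear0 scaler0 ffunE scaler0 addr0.
Qed.

End Composition.

(** For c = 1 the j-th operator has value S u at j, so L_1 = ker S contains K,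
    and S carries the operator to B_j.  Surjectivity of S is ( ** ) for
    tau = 0, here taken from the diagonal map on constant targets. *)
Theorem mc1_iso (K : fieldType) (N : nat) (V : vectType K)
    (B : 'I_N.+1 -> 'End(V)) (hdbl : dblstar B) : tuple_iso (mc_tuple B 1) B.
Proof.
pose f := quotv_pi (conv_K B + conv_L B 1)%VS.
apply: (@tuple_iso_of_presentations _ _ _ _ _ f (wsum B) (conv B 1)).
- by move=> y; exists (quotv_repr y); apply: quotv_reprK.
- move=> v; have [x xv] := conv_diag_surj hdbl (oner_neq0 K) [ffun=> v].
  exists (x ord0); move/ffunP: xv => /(_ ord0).
  by rewrite !ffunE subrr scale0r add0r scale1r.
- move=> u; split=> [/quotv_pi_eq0/memv_addP[k kK [l /mem_conv_L lL ->]]|u0].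
    rewrite linearD /= wsum_K// add0r.
    by have := lL ord0; rewrite subrr scale0r add0r scale1r.
  apply/quotv_pi_eq0; apply: (subvP (addvSr _ _)); apply/mem_conv_L => j.
  by rewrite u0 subrr scale0r scaler0 addr0.
- by move=> j u; rewrite [RHS]mc_tupleE.
- move=> j u; rewrite conv_single /= wsum_single.
  by rewrite subrr scale0r add0r scale1r.
Qed.

(** * Powers of q *)

Section ComplexPowers.
Variable R : realType.

Lemma cexpD (z w : R[i]) : cexp (z + w) = cexp z * cexp w.
Proof.
case: z w => [a b] [a' b']; rewrite /cexp /= expRD cosD sinD.
by apply/eqP; rewrite eq_complex /=; apply/andP; split; apply/eqP; ring.
Qed.

Lemma cexp0 : cexp (0 : R[i]) = 1.
Proof. by rewrite /cexp /= expR0 cos0 sin0 mulr1 mulr0. Qed.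

Lemma qpowD (logq a b : R[i]) : qpow logq (a + b) = qpow logq a * qpow logq b.
Proof. by rewrite /qpow mulrDl cexpD. Qed.

Lemma qpow0 (logq : R[i]) : qpow logq 0 = 1.
Proof. by rewrite /qpow mul0r cexp0. Qed.

Lemma qpow_neq0 (logq a : R[i]) : qpow logq a != 0.
Proof.
apply/eqP => a0; have := qpowD logq a (- a); rewrite subrr qpow0 a0 mul0r.
by apply/eqP; rewrite oner_eq0.
Qed.

End ComplexPowers.

Theorem theorem5p8 (R : realType) (q logq : R[i])
    (hq0 : 0 < `|q|) (hq1 : `|q| < 1) (hlogq : cexp logq = q)
    (V : vectType R[i]) (N : nat) (B : 'I_N.+1 -> 'End(V))
    (hstar : star B) (hdblstar : dblstar B) :
  (forall lambda1 lambda2 : R[i],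
     tuple_iso (mcq logq lambda2 (mcq logq lambda1 B))
               (mcq logq (lambda1 + lambda2) B)) /\
  (forall lambda : R[i],
     tuple_iso (mcq logq (- lambda) (mcq logq lambda B)) B).
Proof.
have comp l1 l2 : tuple_iso (mcq logq l2 (mcq logq l1 B))
                            (mcq logq (l1 + l2) B).
  rewrite /mcq /mcq_space opprD addrC qpowD.
  by apply: mc_mc_iso => //; apply: qpow_neq0.
split=> // l; apply: tuple_iso_trans (comp l (- l)) _.
by rewrite /mcq /mcq_space subrr oppr0 qpow0; apply: mc1_iso.
Qed.
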